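(* Let $(a_0,b_0)$ be any pair of positive integers and let $(\mathbb{Y}_n)_{n\ge 0}$ be the Pólya walk starting at $\mathbb{Y}_0=(a_0,b_0)$. For each integer $N\ge 1$ let $Q_N=\frac1N\sum_{n=1}^N I(\mathbb{Y}_n)$. Then \[ \lim_{N\to\infty} Q_N=\frac{1}{\zeta(2)}\quad\text{almost surely}. \]
   Context: $\mathbb{N}=\{1,2,3,\dots\}$ and $\zeta$ is the Riemann zeta function. The Pólya walk starting at $(a_0,b_0)\in\mathbb{N}^2$ is the discrete-time stochastic process $(\mathbb{Y}_n)_{n\ge0}$ in $\mathbb{N}^2$ with deterministic start $\mathbb{Y}_0=(a_0,b_0)$ such that, for each $n\ge 0$, given the history up to time $n$ with current position $\mathbb{Y}_n=(a_n,b_n)$, the jump $\mathbb{Y}_{n+1}-\mathbb{Y}_n$ equals $(1,0)$ with conditional probability $\frac{a_n}{a_n+b_n}$ and $(0,1)$ with conditional probability $\frac{b_n}{a_n+b_n}$. The function $I:\mathbb{N}^2\to\{0,1\}$ is the indicator of the set of visible points: $I(x,y)=1$ if $\gcd(x,y)=1$ and $I(x,y)=0$ otherwise. *)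

(* Defs.v *)
From HB Require Import structures.
From mathcomp Require Import all_boot all_order all_algebra.
From mathcomp Require Import all_classical all_reals all_analysis.

Set Implicit Arguments.
Unset Strict Implicit.
Unset Printing Implicit Defensive.

Import Order.TTheory GRing.Theory Num.Theory.
Import numFieldNormedType.Exports.

Local Open Scope classical_set_scope.
Local Open Scope ring_scope.

(* The Dirichlet series; it represents the Riemann zeta function for real
   s > 1 only. *)
Definition zeta (R : realType) (s : R) : R := limn (series (riemannR s)).

(* Elementary conditional probability P(A | B); meaningful when P B != 0. *)
Definition cond_prob d (T : measurableType d) (R : realType)
    (P : probability T R) (A B : set T) : R :=
  fine (P (A `&` B)) / fine (P B).

(* The event that the process follows the path h up to time n. *)
Definition history (T S : Type) (Y : nat -> T -> S) (n : nat) (h : nat -> S) :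
    set T :=
  [set w | forall k, (k <= n)%N -> Y k w = h k].

(* The process takes values in a countable set, so conditioning on its past up
   to time n amounts to conditioning on each path h followed up to time n with
   positive probability; (h n).1 and (h n).2 are then the coordinates of the
   current position. *)
Record polya_walk d (T : measurableType d) (R : realType)
    (P : probability T R) (Y : nat -> {RV P >-> (nat * nat)%type})
    (a0 b0 : nat) : Prop := PolyaWalk {
  polya_pos : forall n w, (0 < (Y n w).1)%N /\ (0 < (Y n w).2)%N ;
  polya_start : forall w, Y 0%N w = (a0, b0) ;
  polya_right : forall n (h : nat -> nat * nat),
    P (history Y n h) != 0%E ->
    cond_prob P [set w | Y n.+1 w = (((Y n w).1 + 1)%N, (Y n w).2)]
                (history Y n h)
    = (h n).1%:R / ((h n).1 + (h n).2)%:R ;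
  polya_up : forall n (h : nat -> nat * nat),
    P (history Y n h) != 0%E ->
    cond_prob P [set w | Y n.+1 w = ((Y n w).1, ((Y n w).2 + 1)%N)]
                (history Y n h)
    = (h n).2%:R / ((h n).1 + (h n).2)%:R }.

Definition visible (R : realType) (z : nat * nat) : R := (coprime z.1 z.2)%:R.

Definition visible_mean (R : realType) (T : Type) (Y : nat -> T -> nat * nat)
    (N : nat) (w : T) : R :=
  N%:R^-1 * \sum_(1 <= n < N.+1) visible R (Y n w).

(* Main.v *)
Require Import Defs.
From HB Require Import structures.
From mathcomp Require Import all_boot all_order all_algebra.
From mathcomp Require Import all_classical all_reals all_analysis.
From mathcomp Require Import ring lra zify.

(** Write 1[gcd(x, y) = 1] as the sum of mu(d) over the common divisors d of x
    and y.  The number of visible points among the first N positions is then the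
    sum over d of mu(d) W_d, where W_d counts the n <= N such that d divides
    both coordinates at time n ([hits]).  Everything rests on W_d being close to
    N / d^2, since the sum of mu(d) / d^2 is 1 / zeta(2).

    The sum of the coordinates at time n is a0 + b0 + n, so d divides both
    coordinates exactly when it divides a0 + b0 + n, which selects one time in d,
    and divides the first coordinate.  The steps of the walk are exchangeable, hence
    stationary ([polyaE_stationary]): the number of right steps between times m
    and n has the law of the number of right steps among the first n - m.  For
    the walk started at (1, 1) this law is uniform ([polyaE_uniform]), so that a
    given residue class modulo d has probability at most 1/d + 1/(n - m + 1).
    Any other starting point is reached from (1, 1) with positive probability,
    and so its walk obeys the same bounds up to a constant factor
    ([polyaE_le_start11]).

    An upper bound for one class is enough for equidistribution.  If U_j counts
    the selected times at which the first coordinate is j modulo d, and M the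
    selected times, then the sum over j of (U_j - M/d)^2 equals the sum over
    pairs of selected times (m, n) of 1[first coordinates congruent] - 1/d
    ([sum_residues_sqr]).  The expectation of each term is at most a multiple of
    1/(|n - m| + 1), so the mean square of W_d - M/d is of lower order than N^2,
    uniformly in d ([hits_sqr_error_le]).

    For N = D^8 this controls all d <= D at once, while the expectation of W_d is
    O(N / d^2) for every d, so the divisors d > D contribute O(N / D)
    ([visible_count_L1_error]).  With D = k^4, the Markov inequality bounds the
    probability of a deviation exceeding 1/k by O(1/k^2); the Borel-Cantelli
    lemma gives almost sure convergence along N = k^32, and this sequence grows
    slowly enough for bounded averages to converge along all N
    ([cvg_mean_along_powers]). *)

Set Implicit Arguments.
Unset Strict Implicit.
Unset Printing Implicit Defensive.

Import Order.TTheory GRing.Theory Num.Theory.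
Import numFieldNormedType.Exports.

Local Open Scope classical_set_scope.
Local Open Scope ring_scope.

(** * The expectation of a function of the first steps *)

Section PolyaExpectation.
Variable R : realFieldType.
Implicit Types (F G : seq bool -> R) (a b n : nat).

(** [polyaE n F a b] is the expectation of [F] at the sequence of the first [n]
    steps of the walk started at [(a, b)], [true] being a step to the right.
    Conditioning on the first step makes linearity, comparison and the
    dependence on the starting point provable by induction on [n]. *)
Fixpoint polyaE n F a b : R :=
  if n is n'.+1 then
    (a%:R * polyaE n' (fun e => F (true :: e)) a.+1 b
     + b%:R * polyaE n' (fun e => F (false :: e)) a b.+1) / (a + b)%:R
  else F [::].

Lemma polyaE_le n F G a b :
  (forall e, size e = n -> F e <= G e) -> polyaE n F a b <= polyaE n G a b.
Proof.
elim: n F G a b => [|n IH] F G a b FG /=; first exact: FG.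
by rewrite ler_wpM2r ?invr_ge0 ?ler0n// lerD// ler_wpM2l ?ler0n// IH// => e se;
  apply: FG; rewrite /= se.
Qed.

Lemma eq_polyaE n F G a b :
  (forall e, size e = n -> F e = G e) -> polyaE n F a b = polyaE n G a b.
Proof.
by move=> FG; apply/eqP; rewrite eq_le !polyaE_le// => e /FG ->.
Qed.

Lemma polyaED n F G a b :
  polyaE n (fun e => F e + G e) a b = polyaE n F a b + polyaE n G a b.
Proof. by elim: n F G a b => [|n IH] F G a b //=; rewrite !IH; ring. Qed.

Lemma polyaEZ n (c : R) F a b :
  polyaE n (fun e => c * F e) a b = c * polyaE n F a b.
Proof. by elim: n F a b => [|n IH] F a b //=; rewrite !IH; ring. Qed.

Lemma polyaE_cst n (c : R) a b : (0 < a + b)%N -> polyaE n (fun=> c) a b = c.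
Proof.
elim: n a b => [|n IH] a b ab //=; rewrite !IH ?addSn ?addnS//.
rewrite -mulrDl -natrD mulrAC divff ?mul1r// pnatr_eq0; lia.
Qed.

Lemma polyaE_sum n (I : Type) (r : seq I) (Q : pred I) (F : I -> seq bool -> R)
    a b : (0 < a + b)%N ->
  polyaE n (fun e => \sum_(i <- r | Q i) F i e) a b
  = \sum_(i <- r | Q i) polyaE n (F i) a b.
Proof.
move=> ab; elim: r => [|i r IH].
  by rewrite big_nil -[RHS](polyaE_cst n 0 ab); apply: eq_polyaE => e _; rewrite big_nil.
rewrite big_cons -IH; case: ifP => Qi.
  by rewrite -polyaED; apply: eq_polyaE => e _; rewrite big_cons Qi.
by apply: eq_polyaE => e _; rewrite big_cons Qi.
Qed.

Lemma polyaE_ge0 n F a b :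
  (forall e, size e = n -> 0 <= F e) -> 0 <= polyaE n F a b.
Proof.
elim: n F a b => [|n IH] F a b F0 /=; first exact: F0.
by rewrite divr_ge0 ?ler0n ?addr_ge0 ?mulr_ge0 ?ler0n ?IH// => e se;
  apply: F0; rewrite /= se.
Qed.

Lemma polyaE_take m n F a b : (0 < a + b)%N ->
  polyaE (m + n) (fun e => F (take m e)) a b = polyaE m F a b.
Proof.
elim: m F a b => [|m IH] F a b ab.
  by under [LHS]eq_polyaE do rewrite take0; rewrite polyaE_cst.
rewrite addSn /=.
rewrite (IH (fun e => F (true :: e))) ?addSn ?addnS//.
by rewrite (IH (fun e => F (false :: e))) ?addSn ?addnS.
Qed.

(** Forgetting the first step does not change the law of the steps.  Expanding
    the next step on both sides leaves two-step terms, and these agree because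
    right-up and up-right have the same weight a b. *)
Lemma polyaE_stationary n F a b : (0 < a + b)%N ->
  polyaE n.+1 (fun e => F (behead e)) a b = polyaE n F a b.
Proof.
(* Only the extra step is unfolded; [polyaE n] must stay folded to match the
   induction hypothesis. *)
change ((0 < a + b)%N ->
  (a%:R * polyaE n F a.+1 b + b%:R * polyaE n F a b.+1) / (a + b)%:R
  = polyaE n F a b).
elim: n F a b => [|n IH] F a b ab.
  by rewrite /= -mulrDl -natrD mulrAC divff ?mul1r// pnatr_eq0; lia.
rewrite /= -(IH _ a.+1 b) ?addSn// -(IH _ a b.+1) ?addnS// ?addSn ?addnS.
have s0 : a%:R + b%:R != 0 :> R by rewrite -natrD pnatr_eq0; lia.
have s1 : a%:R + b%:R + 1 != 0 :> R by rewrite -natrD -(natrD _ _ 1) pnatr_eq0; lia.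
rewrite -!(natr1 (a + b)) -!(natr1 a) -!(natr1 b) natrD.
by field; rewrite s0 s1.
Qed.

Lemma polyaE_drop m n F a b : (0 < a + b)%N ->
  polyaE (m + n) (fun e => F (drop m e)) a b = polyaE n F a b.
Proof.
move=> ab; elim: m => [|m IH]; first by under eq_polyaE do rewrite drop0.
rewrite -IH addSn -[RHS]polyaE_stationary//; apply: eq_polyaE => -[|x e]//.
Qed.

Lemma polyaE_window m n r F a b : (0 < a + b)%N ->
  polyaE (m + n + r) (fun e => F (take n (drop m e))) a b = polyaE n F a b.
Proof.
move=> ab; rewrite -addnA (polyaE_drop _ _ (fun e => F (take n e)))//.
exact: polyaE_take.
Qed.

(** The walk from (1, 1) visits (a, b) with positive probability, and by
    stationarity its later steps have the law of its first ones; the inverse of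
    that probability is a possible constant. *)
Lemma polyaE_le_start11 a b : (0 < a)%N -> (0 < b)%N -> exists2 C : R, 0 <= C &
  forall n F, (forall e, size e = n -> 0 <= F e) ->
    polyaE n F a b <= C * polyaE n F 1 1.
Proof.
elim: a b => // a IHa b _; elim: b => // b IHb _.
have [a0|a0] := posnP a; last first.
  have [C C0 HC] := IHa b.+1 a0 isT.
  exists ((a + b.+1)%:R / a%:R * C); first by rewrite mulr_ge0 ?divr_ge0.
  move=> n F F0; have ap : (0 < a%:R :> R) by rewrite ltr0n.
  rewrite [leRHS](_ : _ = (a + b.+1)%:R * (C * polyaE n F 1 1) / a%:R); last ring.
  rewrite ler_pdivlMr//.
  apply: le_trans (_ : (a + b.+1)%:R * polyaE n F a b.+1 <= _); last first.
    by rewrite ler_wpM2l// HC.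
  rewrite -[polyaE n F a b.+1]polyaE_stationary/= ?addnS// mulrCA divff ?pnatr_eq0// mulr1.
  by rewrite mulrC lerDl mulr_ge0// polyaE_ge0.
have [b0|b0] := posnP b; first by rewrite a0 b0; exists 1 => // n F _; rewrite mul1r.
have [C C0 HC] := IHb b0.
exists ((a.+1 + b)%:R / b%:R * C); first by rewrite mulr_ge0 ?divr_ge0.
move=> n F F0; have bp : (0 < b%:R :> R) by rewrite ltr0n.
rewrite [leRHS](_ : _ = (a.+1 + b)%:R * (C * polyaE n F 1 1) / b%:R); last ring.
rewrite ler_pdivlMr//.
apply: le_trans (_ : (a.+1 + b)%:R * polyaE n F a.+1 b <= _); last first.
  by rewrite ler_wpM2l// HC.
rewrite -[polyaE n F a.+1 b]polyaE_stationary/= ?addSn// mulrCA divff ?pnatr_eq0// mulr1.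
by rewrite mulrC lerDr mulr_ge0// polyaE_ge0.
Qed.

(** Conditioning on the last step: after [n] steps [e], the walk is at
    [(a + count id e, b + n - count id e)]. *)
Lemma polyaE_rcons n F a b :
  polyaE n.+1 F a b
  = polyaE n (fun e => ((a + count id e)%:R * F (rcons e true)
      + ((b + n)%:R - (count id e)%:R) * F (rcons e false)) / (a + b + n)%:R) a b.
Proof.
elim: n F a b => [|n IH] F a b; first by rewrite /= !addn0 subr0.
rewrite [LHS](_ : _ = (a%:R * polyaE n.+1 (fun e => F (true :: e)) a.+1 b
  + b%:R * polyaE n.+1 (fun e => F (false :: e)) a b.+1) / (a + b)%:R)//.
rewrite (IH (fun e => F (true :: e))) (IH (fun e => F (false :: e))) /=.
congr ((_ * _ + _ * _) / _); apply: eq_polyaE => e _ /=.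
  have -> : (a.+1 + b + n = a + b + n.+1)%N by lia.
  rewrite addSnnS add1n (addnS b) -[(b + n).+1%:R]natr1.
  by rewrite -[(count id e).+1%:R]natr1; congr (_ / _); ring.
have -> : (a + b.+1 + n = a + b + n.+1)%N by lia.
by rewrite addSnnS.
Qed.

(** The Polya urn started with one ball of each colour: the number of balls
    added of one colour is uniform. *)
Lemma polyaE_uniform n (f : nat -> R) :
  polyaE n (fun e => f (count id e)) 1 1 = (\sum_(0 <= i < n.+1) f i) / n.+1%:R.
Proof.
elim: n f => [|n IH] f; first by rewrite /= big_nat1 divr1.
rewrite polyaE_rcons.
pose g i : R := ((1 + i)%:R * f i.+1 + ((1 + n)%:R - i%:R) * f i) / (1 + 1 + n)%:R.
rewrite (@eq_polyaE _ _ (fun e => g (count id e))); last first.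
  by move=> e _; rewrite /g -!cats1 !count_cat/= !addn0 addn1.
rewrite IH /g -mulr_suml big_split/=.
have E1 : \sum_(0 <= i < n.+1) (1 + i)%:R * f i.+1 = \sum_(0 <= i < n.+2) i%:R * f i.
  by rewrite [RHS]big_nat_recl// mul0r add0r.
have E2 : \sum_(0 <= i < n.+1) ((1 + n)%:R - i%:R) * f i
    = \sum_(0 <= i < n.+2) ((1 + n)%:R - i%:R) * f i.
  by rewrite [RHS]big_nat_recr//= subrr mul0r addr0.
rewrite E1 E2 -big_split/=.
under eq_bigr => i _ do rewrite -mulrDl addrC subrK.
rewrite -mulr_sumr !add1n; set S := \sum_(_ <= i < _) _; field.
by rewrite nat1r -natrD !pnatr_eq0 addSn.
Qed.

End PolyaExpectation.

(** * Visits to the lattice of points with both coordinates divisible by d *)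

Lemma count_multiples d s N : (0 < d)%N ->
  (\sum_(1 <= n < N.+1) (d %| s + n) + s %/ d = (s + N) %/ d)%N.
Proof.
move=> d0; elim: N => [|N IH]; first by rewrite big_geq// addn0.
by rewrite big_nat_recr//= addnAC IH addnS divnS// addnC.
Qed.

Section Moments.
Variable R : realFieldType.
Implicit Types (a b n d : nat).

Lemma count_multiples_bound d s N : (0 < d)%N ->
  `|(\sum_(1 <= n < N.+1) (d %| s + n)%N)%:R - N%:R / d%:R| <= 1 :> R.
Proof.
move=> d0; have := count_multiples s N d0.
set M := (\sum_(_ <= n < _) _)%N => ME.
have dp : 0 < d%:R :> R by rewrite ltr0n.
have r1 := ltn_pmod s d0; have r2 := ltn_pmod (s + N) d0.
have e1 := divn_eq s d; have e2 := divn_eq (s + N) d.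
have h1 : (M * d <= N + d)%N by nia.
have h2 : (N <= M * d + d)%N by nia.
rewrite ler_distl; apply/andP; split.
  rewrite lerBlDr ler_pdivrMr// mulrDl mul1r -natrM -natrD ler_nat; lia.
rewrite -[X in _ <= _ + X](@divff _ d%:R) ?gt_eqF// -mulrDl ler_pdivlMr//.
by rewrite -natrM -natrD ler_nat.
Qed.

(** The interval [0, n] contains at most (n + 1)/d + 1 elements of a residue
    class modulo d. *)
Lemma polyaE_residue n c d : (0 < d)%N ->
  polyaE n (fun e => (d %| c + count id e)%N%:R) 1 1 <= d%:R^-1 + n.+1%:R^-1 :> R.
Proof.
move=> d0.
rewrite (polyaE_uniform n (fun i => (d %| c + i)%N%:R : R)).
(* The shift by d - 1 turns a sum from 0 into a sum from 1. *)
have -> : \sum_(0 <= i < n.+1) (d %| c + i)%N%:R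
    = (\sum_(1 <= i < n.+2) (d %| (c + d.-1) + i)%N)%:R :> R.
  rewrite natr_sum [RHS]big_add1/=; apply: eq_bigr => i _; congr (_%:R).
  have -> : (c + d.-1 + i.+1 = c + i + d)%N by lia.
  by congr nat_of_bool; rewrite [RHS]dvdn_addl.
have np : 0 < n.+1%:R :> R by rewrite ltr0n.
rewrite ler_pdivrMr// mulrDl mulVf ?gt_eqF// mulrC.
have := count_multiples_bound (c + d.-1) n.+1 d0.
by rewrite ler_distl => /andP[_].
Qed.

Definition position a b (e : seq bool) : nat * nat :=
  ((a + count id e)%N, (b + count negb e)%N).

Lemma position_sum a b e :
  ((position a b e).1 + (position a b e).2 = a + b + size e)%N.
Proof. by rewrite /= -(count_predC id e) addnACA. Qed.

Definition divides_pos d (z : nat * nat) := (d %| z.1)%N && (d %| z.2)%N.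

Lemma divides_positionE d a b e :
  divides_pos d (position a b e)
  = (d %| a + b + size e)%N && (d %| a + count id e)%N.
Proof.
rewrite -position_sum /divides_pos /=; case: (boolP (d %| a + _)%N) => [da|_].
  by rewrite andbT [RHS]dvdn_addr.
by rewrite andbF.
Qed.

Definition hits d N a b (e : seq bool) : R :=
  \sum_(1 <= n < N.+1) (divides_pos d (position a b (take n e)))%:R.

Lemma hitsE d N a b e : size e = N ->
  hits d N a b e
  = \sum_(1 <= n < N.+1 | (d %| a + b + n)%N)
       (d %| a + count id (take n e))%N%:R.
Proof.
move=> se; rewrite big_mkcond /hits !big_nat; apply: eq_bigr => n /andP[_ nN].
rewrite divides_positionE size_takel ?se//; case: ifP => //.
Qed.

(** A time n that counts satisfies d <= a + b + n, so the error 1/(n + 1) in the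
    probability of a residue class is itself O(1/d); and at most (a + b + N)/d
    times qualify. *)
Lemma hits_mean_le a b : (0 < a)%N -> (0 < b)%N -> exists2 C : R, 0 <= C &
  forall d N, (0 < d)%N -> (0 < N)%N ->
    polyaE N (hits d N a b) a b <= C * (N%:R / d%:R ^+ 2).
Proof.
move=> a0 b0; have [C C0 HC] := polyaE_le_start11 R a0 b0.
have ab : (0 < a + b)%N by lia.
exists (C * (1 + (a + b)%:R) ^+ 2); first by rewrite mulr_ge0// sqr_ge0.
move=> d N d0 N0.
have dp : 0 < d%:R :> R by rewrite ltr0n.
rewrite (eq_polyaE _ _ (hitsE d a b)) polyaE_sum//.
apply: (@le_trans _ _ (\sum_(1 <= n < N.+1 | (d %| a + b + n)%N)
    (C * (1 + (a + b)%:R) / d%:R))).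
  rewrite big_nat_cond [leRHS]big_nat_cond.
  apply: ler_sum => n /andP[/andP[n1 nN] dn].
  have -> : N = (n + (N - n))%N by lia.
  rewrite (polyaE_take _ _ (fun e => (d %| a + count id e)%N%:R))//.
  apply: le_trans (HC _ _ _) _ => //; rewrite -mulrA ler_wpM2l//.
  apply: le_trans (polyaE_residue _ _ d0) _.
  rewrite mulrDl mul1r lerD2l// ler_pdivlMr// mulrC ler_pdivrMr ?ltr0n//.
  rewrite -natrM ler_nat; have := dvdn_leq _ dn; nia.
under eq_bigr do rewrite -[C * _ / _]mul1r.
rewrite -mulr_suml -(natr_sum _ _ _ (fun=> 1%N)).
have cb : (\sum_(1 <= n < N.+1 | (d %| a + b + n)%N) 1 <= (a + b + N) %/ d)%N.
  by rewrite -(count_multiples _ _ d0) big_mkcond/= leq_addr.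
apply: (@le_trans _ _ ((a + b + N)%:R / d%:R * (C * (1 + (a + b)%:R) / d%:R))).
  rewrite ler_wpM2r ?divr_ge0 ?mulr_ge0 ?addr_ge0//.
  rewrite ler_pdivlMr// -natrM ler_nat (leq_trans _ (leq_trunc_div _ d))//.
  by rewrite leq_mul2r cb orbT.
rewrite [leLHS](_ : _ = C * (1 + (a + b)%:R) / d%:R ^+ 2 * (a + b + N)%:R); last first.
  by field; rewrite gt_eqF.
rewrite [leRHS](_ : _ =
  C * (1 + (a + b)%:R) / d%:R ^+ 2 * (N%:R * (1 + (a + b)%:R))); last first.
  by field; rewrite gt_eqF.
rewrite ler_wpM2l ?divr_ge0 ?mulr_ge0 ?addr_ge0 ?exprn_ge0//.
by rewrite nat1r -natrM ler_nat; nia.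
Qed.

(** Expanding the square, the product of the two indicators summed over all
    classes j is the indicator that [u m] and [u n] are congruent.  This turns a
    one-sided bound on the probability of a congruence into a bound on a sum of
    squares. *)
Lemma sum_residues_sqr d (r : seq nat) (Q : pred nat) (u : nat -> nat) :
  (0 < d)%N ->
  \sum_(j < d) (\sum_(n <- r | Q n) ((u n %% d == j)%N%:R - d%:R^-1)) ^+ 2
  = \sum_(m <- r | Q m) \sum_(n <- r | Q n)
      ((u m == u n %[mod d])%N%:R - d%:R^-1) :> R.
Proof.
move=> d0; have dp : d%:R != 0 :> R by rewrite pnatr_eq0 -lt0n.
under eq_bigr => j _ do rewrite expr2 big_distrlr/=.
rewrite exchange_big/=; apply: eq_bigr => m _.
rewrite exchange_big/=; apply: eq_bigr => n _.
have one x : \sum_(j < d) (x %% d == j)%N%:R = 1 :> R.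
  rewrite (bigD1 (Ordinal (ltn_pmod x d0)))//= eqxx big1 ?addr0// => j.
  by rewrite -val_eqE/= eq_sym => /negbTE ->.
have two : \sum_(j < d) (u m %% d == j)%N%:R * (u n %% d == j)%N%:R
    = (u m == u n %[mod d])%N%:R :> R.
  rewrite (bigD1 (Ordinal (ltn_pmod (u m) d0)))//= eqxx mul1r big1 ?addr0.
    by rewrite eq_sym.
  by move=> j; rewrite -val_eqE/= eq_sym => /negbTE ->; rewrite mul0r.
have three : \sum_(j < d) d%:R^-1 * d%:R^-1 = d%:R^-1 :> R.
  by rewrite sumr_const card_ord -[LHS]mulr_natr -mulrA mulVf// mulr1.
under eq_bigr => j _ do rewrite mulrBl !mulrBr.
rewrite !sumrB two three -mulr_suml -mulr_sumr !one mulr1 mul1r.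
ring.
Qed.

Lemma polyaE_increment N c d m n : (0 < d)%N -> (m <= N)%N -> (n <= N)%N ->
  polyaE N (fun e => (c + count id (take m e) == c + count id (take n e) %[mod d])%N%:R)
    1 1 <= d%:R^-1 + (`|m%:Z - n%:Z|%N.+1)%:R^-1 :> R.
Proof.
move=> d0; wlog mn : m n / (m <= n)%N => [hw mN nN|mN nN].
  have [mn|/ltnW nm] := leqP m n; first exact: hw.
  rewrite distnC (le_trans _ (hw _ _ nm nN mN))//.
  by apply: polyaE_le => e _; rewrite eq_sym.
have -> : `|m%:Z - n%:Z|%N = (n - m)%N by lia.
have -> : N = (m + (n - m) + (N - n))%N by lia.
rewrite (le_trans _ (polyaE_residue (n - m) 0 d0))//.
rewrite -(@polyaE_window _ m (n - m) (N - n) (fun e => (d %| 0 + count id e)%N%:R))//.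
apply: polyaE_le => e _.
have -> : take n e = take m e ++ take (n - m) (drop m e).
  by rewrite take_drop subnK// -[X in X ++ _](take_takel e mn) cat_take_drop.
by rewrite count_cat addnA add0n -[X in X == _ %[mod d]]addn0 eqn_modDl mod0n eq_sym.
Qed.

Lemma card_near m K N :
  (\sum_(1 <= n < N.+1) (`|m%:Z - n%:Z| < K) <= K.*2)%N.
Proof.
rewrite -big_mkcond sum1_count -size_filter.
rewrite -[leqRHS](size_iota (m.+1 - K)); apply: uniq_leq_size.
  by rewrite filter_uniq// iota_uniq.
by move=> n; rewrite mem_filter mem_iota => /andP[]; rewrite mem_index_iota; lia.
Qed.

(** The splitting parameter K avoids logarithms: 1/(l + 1) is at most 1/K,
    unless l < K, when it is at most 1. *)
Lemma sum_inverse_distance K N : (0 < K)%N ->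
  \sum_(1 <= m < N.+1) \sum_(1 <= n < N.+1) (`|m%:Z - n%:Z|%N.+1)%:R^-1
  <= N%:R * (N%:R / K%:R + (K.*2)%:R) :> R.
Proof.
move=> K0; have Kp : 0 < K%:R :> R by rewrite ltr0n.
have cst (x : R) : \sum_(1 <= n < N.+1) x = N%:R * x.
  by rewrite sumr_const_nat subn1 [RHS]mulr_natl.
rewrite -[leRHS]cst; apply: ler_sum => m _.
apply: (@le_trans _ _ (\sum_(1 <= n < N.+1) (K%:R^-1 + (`|m%:Z - n%:Z| < K)%N%:R))).
  apply: ler_sum => n _; case: ltnP => [_|h].
    rewrite -[leLHS]add0r lerD ?invr_ge0// invf_le1 ?ltr0n// ler1n//.
  by rewrite addr0 lef_pV2 ?posrE ?ltr0n// ler_nat; lia.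
by rewrite big_split/= cst lerD2l -natr_sum ler_nat card_near.
Qed.

(** The square of the class 0 is bounded by the sum of squares over all classes,
    a nonnegative function of the steps, so that the starting point can be
    changed to (1, 1); there [sum_residues_sqr] and stationarity apply. *)
Lemma hits_sqr_error_le a b : (0 < a)%N -> (0 < b)%N -> exists2 C : R, 0 <= C &
  forall d N K, (0 < d)%N -> (0 < K)%N ->
    polyaE N (fun e => (hits d N a b e
        - (\sum_(1 <= n < N.+1) (d %| a + b + n))%N%:R / d%:R) ^+ 2) a b
    <= C * (N%:R * (N%:R / K%:R + (K.*2)%:R)).
Proof.
move=> a0 b0; have [C C0 HC] := polyaE_le_start11 R a0 b0; exists C => // d N K d0 K0.
apply: le_trans (HC _ _ (fun e _ => sqr_ge0 _)) _; rewrite ler_wpM2l//.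
pose Q n := (d %| a + b + n)%N.
pose u e n := (a + count id (take n e))%N.
pose G e : R := \sum_(m <- index_iota 1 N.+1 | Q m)
  \sum_(n <- index_iota 1 N.+1 | Q n) ((u e m == u e n %[mod d])%N%:R - d%:R^-1).
apply: (@le_trans _ _ (polyaE N G 1 1)).
  apply: polyaE_le => e se; rewrite /G -sum_residues_sqr// (bigD1 (Ordinal d0))//=.
  rewrite -[leLHS]addr0 lerD ?sumr_ge0// => [|j _]; last exact: sqr_ge0.
  have -> : (\sum_(1 <= n < N.+1) (d %| a + b + n))%N%:R / d%:R
      = \sum_(n <- index_iota 1 N.+1 | Q n) d%:R^-1 :> R.
    rewrite natr_sum mulr_suml [RHS]big_mkcond; apply: eq_bigr => n _.
    by rewrite /Q; case: ifP; rewrite ?mul1r ?mul0r.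
  by rewrite hitsE// -sumrB.
rewrite (polyaE_sum _ _ _ (fun m e => _))//.
apply: le_trans _ (sum_inverse_distance N K0).
have step (F H : nat -> R) : (forall m, (m <= N)%N -> F m <= H m) ->
    (forall m, 0 <= H m) -> \sum_(1 <= m < N.+1 | Q m) F m <= \sum_(1 <= m < N.+1) H m.
  move=> FH H0; rewrite big_mkcond big_nat [leRHS]big_nat/=.
  by apply: ler_sum => m /andP[_ mN]; case: ifP => _ //; apply: FH.
apply: (step _ _) => [m mN|m]; last by apply: sumr_ge0 => n _; rewrite invr_ge0.
rewrite (polyaE_sum _ _ _ (fun n e => _))//.
apply: step => [n nN|n]; last by rewrite invr_ge0.
rewrite polyaED polyaE_cst// lerBlDr [leRHS]addrC.
exact: polyaE_increment.
Qed.

(** With K = j^2 the mean square error is O(j^6); the weight T = j^3 balances the two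
    terms of |y| <= T + y^2 / T. *)
Lemma hits_L1_error a b : (0 < a)%N -> (0 < b)%N -> exists2 C : R, 0 <= C &
  forall d j N, (0 < d)%N -> (0 < j)%N -> N = (j ^ 4)%N ->
    polyaE N (fun e => `|hits d N a b e - N%:R / d%:R ^+ 2|) a b <= C * j%:R ^+ 3.
Proof.
move=> a0 b0; have [C C0 HC] := hits_sqr_error_le a0 b0.
exists (2 + C * 3); first by rewrite addr_ge0// mulr_ge0.
move=> d j N d0 j0 NE.
have jp : 0 < j%:R :> R by rewrite ltr0n.
have j1 : 1 <= j%:R :> R by rewrite ler1n.
have dp : 0 < d%:R :> R by rewrite ltr0n.
have d1 : 1 <= d%:R :> R by rewrite ler1n.
set M : R := (\sum_(1 <= n < N.+1) (d %| a + b + n))%N%:R.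
have := HC d N (j ^ 2)%N d0; rewrite expn_gt0 j0 => /(_ isT); rewrite -/M => HV.
set T : R := j%:R ^+ 3.
have T1 : 1 <= T by rewrite /T exprn_ege1.
have Tp : 0 < T by rewrite (lt_le_trans _ T1).
have HM : `|M / d%:R - N%:R / d%:R ^+ 2| <= T.
  have -> : M / d%:R - N%:R / d%:R ^+ 2 = (M - N%:R / d%:R) / d%:R.
    by field; rewrite gt_eqF.
  rewrite normrM normfV (ger0_norm (ltW dp)) ler_pdivrMr//.
  apply: le_trans (count_multiples_bound (a + b) N d0) _.
  by rewrite -[leLHS]mulr1 ler_pM.
apply: (@le_trans _ _ (polyaE N
    (fun e => 2 * T + T^-1 * (hits d N a b e - M / d%:R) ^+ 2) a b)).
  apply: polyaE_le => e _; set x := hits _ _ _ _ _.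
  have xE : x - N%:R / d%:R ^+ 2 = (x - M / d%:R) + (M / d%:R - N%:R / d%:R ^+ 2).
    by rewrite addrA subrK.
  rewrite xE (le_trans (ler_normD _ _))//.
  set y := x - M / d%:R.
  rewrite mulrDl mul1r -addrA addrC lerD//.
  have -> : T + T^-1 * y ^+ 2 = (T ^+ 2 + `|y| ^+ 2) / T.
    by rewrite real_normK ?num_real//; field; rewrite gt_eqF.
  rewrite ler_pdivlMr//; have := sqr_ge0 (T - `|y|); have := normr_ge0 y; nra.
have ab : (0 < a + b)%N by lia.
rewrite polyaED polyaE_cst// polyaEZ [leRHS]mulrDl lerD2l.
rewrite ler_pdivrMl//; apply: le_trans HV _.
rewrite NE -mul2n natrM !natrX /T.
rewrite le_eqVlt; apply/orP; left; apply/eqP; field.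
by rewrite gt_eqF.
Qed.

Lemma sum_inv_sqr_tail D B : (0 < D)%N ->
  \sum_(D.+1 <= d < D.+1 + B) (d%:R ^+ 2)^-1 <= D%:R^-1 - (D + B)%:R^-1 :> R.
Proof.
move=> D0; elim: B => [|B IH]; first by rewrite addn0 big_geq// addn0 subrr.
rewrite addnS big_nat_recr/= ?leq_addr//; apply: le_trans (lerD IH (lexx _)) _.
rewrite -addrA lerD2l addnS addSn.
have xp : 0 < (D + B)%:R :> R by rewrite ltr0n addn_gt0 D0.
rewrite -natr1; set x : R := (D + B)%:R in xp *.
have h : ((x + 1) ^+ 2)^-1 <= x^-1 - (x + 1)^-1.
  have -> : x^-1 - (x + 1)^-1 = (x * (x + 1))^-1.
    by field; rewrite !gt_eqF//; lra.
  by rewrite lef_pV2 ?posrE; nra.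
lra.
Qed.

End Moments.

(** * The Moebius function *)

Section Mobius.
Variable R : realFieldType.
Implicit Types (d n p : nat).

(** A product over the prime divisors, rather than a case distinction on
    square-free numbers, makes the effect of one more prime factor visible. *)
Definition mobius n : R := \prod_(p <- primes n) - (logn p n == 1)%N%:R.

Lemma mobius1 : mobius 1 = 1. Proof. by rewrite /mobius big_nil. Qed.

Lemma norm_mobius_le1 n : `|mobius n| <= 1.
Proof.
rewrite /mobius normr_prod; elim: (primes n) => [|p s IH]; first by rewrite big_nil.
rewrite big_cons -[leRHS]mulr1 ler_pM ?prodr_ge0//.
by rewrite normrN; case: (_ == _); rewrite ?normr1 ?normr0.
Qed.

Lemma mobius_primeM p d : prime p -> (0 < d)%N -> ~~ (p %| d)%N ->
  mobius (p * d) = - mobius d.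
Proof.
move=> pp d0 pd; have p0 := prime_gt0 pp.
rewrite /mobius (perm_big (p :: primes d)); last first.
  apply: uniq_perm; rewrite ?primes_uniq//= ?primes_uniq ?andbT.
    by rewrite mem_primes pp d0.
  by move=> q; rewrite primesM// primes_prime// !inE.
rewrite big_cons lognM// logn_prime// eqxx (_ : logn p d = 0)%N; last first.
  by apply/eqP; rewrite lognE pp d0 (negbTE pd).
rewrite addn0 /= mulN1r; congr (- _); rewrite !big_seq; apply: eq_bigr => q.
rewrite mem_primes => /and3P[pq _ qd].
rewrite lognM// logn_prime// (_ : (q == p) = false) ?add0n//.
by apply: contraNF pd => /eqP <-.
Qed.

Lemma mobius_primeM0 p d : prime p -> (0 < d)%N -> (p %| d)%N ->
  mobius (p * d) = 0.
Proof.
move=> pp d0 pd; have p0 := prime_gt0 pp.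
rewrite /mobius (big_rem p)/=; last by rewrite mem_primes pp muln_gt0 p0 d0 dvdn_mulr.
rewrite lognM// logn_prime// eqxx lognE pp d0 pd/=.
by rewrite oppr0 mul0r.
Qed.

(** Write n = p m with p prime.  A divisor p e contributes - mu(e) if p does not
    divide e, and 0 otherwise; this cancels the divisors e of n prime to p, which
    are the divisors of m prime to p. *)
Lemma sum_mobius n : (0 < n)%N ->
  \sum_(d <- divisors n) mobius d = (n == 1)%N%:R.
Proof.
move=> n0; have [->|n1] := eqVneq n 1%N.
  by rewrite (_ : divisors 1 = [:: 1%N])// big_seq1 mobius1.
have pp : prime (pdiv n) by rewrite pdiv_prime; lia.
set p := pdiv n in pp; have p0 := prime_gt0 pp.
have [m nE] : exists m, n = (p * m)%N.
  by have /dvdnP[m ->] := pdiv_dvd n; exists m; rewrite mulnC.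
have m0 : (0 < m)%N by move: n0; rewrite nE muln_gt0 => /andP[].
rewrite (bigID (fun d => p %| d)%N)/=.
rewrite -big_filter (perm_big [seq (p * e)%N | e <- divisors m]); last first.
  apply: uniq_perm; first by rewrite filter_uniq ?divisors_uniq.
    by rewrite map_inj_uniq ?divisors_uniq// => x y /eqP; rewrite eqn_pmul2l// => /eqP.
  move=> d; rewrite mem_filter -dvdn_divisors// nE; apply/andP/mapP.
    move=> [/dvdnP[e ->]]; rewrite mulnC dvdn_pmul2l// => em.
    by exists e => //; rewrite -dvdn_divisors.
  by move=> [e]; rewrite -dvdn_divisors// => em ->; rewrite dvdn_mulr// dvdn_pmul2l.
rewrite big_map (bigID (fun d => p %| d)%N)/= big_seq_cond big1 ?add0r; last first.
  move=> e /andP[]; rewrite -dvdn_divisors// => em pe; apply: mobius_primeM0 => //.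
  by rewrite (dvdn_gt0 m0).
rewrite -[X in X + _]big_filter -[X in _ + X]big_filter.
rewrite [X in _ + X](perm_big [seq x <- divisors m | ~~ (p %| x)%N]); last first.
  apply: uniq_perm; rewrite ?filter_uniq ?divisors_uniq// => d.
  rewrite !mem_filter -!dvdn_divisors// nE.
  case: (boolP (p %| d)%N) => //= pd; apply: Gauss_dvdr.
  by rewrite coprime_sym prime_coprime.
rewrite -big_split big_seq big1// => e; rewrite mem_filter -dvdn_divisors// => /andP[pe em].
by rewrite mobius_primeM// 1?(dvdn_gt0 m0)//= addNr.
Qed.

Lemma sum_mobius_range n B : (0 < n)%N -> (n <= B)%N ->
  \sum_(1 <= d < B.+1) mobius d * (d %| n)%N%:R = (n == 1)%N%:R.
Proof.
move=> n0 nB; rewrite -sum_mobius//.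
rewrite [RHS](perm_big [seq d <- index_iota 1 B.+1 | (d %| n)%N]).
  rewrite big_filter [RHS]big_mkcond; apply: eq_bigr => d _.
  by case: ifP => _; rewrite ?mulr1 ?mulr0.
apply: uniq_perm; rewrite ?divisors_uniq// ?filter_uniq ?iota_uniq// => d.
rewrite mem_filter mem_index_iota -dvdn_divisors//.
case: (boolP (d %| n)%N) => //= dn; have := dvdn_leq n0 dn; have := dvdn_gt0 n0 dn.
lia.
Qed.

Definition mobius_sum2 D : R := \sum_(1 <= d < D.+1) mobius d / d%:R ^+ 2.

Lemma sum_multiples d D (f : nat -> R) : (0 < d)%N ->
  \sum_(1 <= n < D.+1 | (d %| n)%N) f n = \sum_(1 <= e < (D %/ d).+1) f (d * e)%N.
Proof.
move=> d0; elim: D => [|D IH]; first by rewrite div0n !big_geq.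
rewrite big_mkcond big_nat_recr//= -big_mkcond IH divnS//.
case: ifP => dD; last by rewrite addr0 add0n.
rewrite add1n [RHS]big_nat_recr//=; congr (_ + f _).
have <- : (D.+1 %/ d = (D %/ d).+1)%N by rewrite divnS// dD.
by rewrite mulnC divnK.
Qed.

(** The sum over n <= D of 1/n^2 times the sum of mu over the divisors of n has
    n = 1 as its only nonzero term; it is reordered by writing n = d e. *)
Lemma mobius_convolution D : (0 < D)%N ->
  \sum_(1 <= d < D.+1) (mobius d / d%:R ^+ 2
    * \sum_(1 <= e < (D %/ d).+1) (e%:R ^+ 2)^-1) = 1.
Proof.
move=> D0.
transitivity (\sum_(1 <= n < D.+1) \sum_(1 <= d < D.+1)
   mobius d * (d %| n)%N%:R * (n%:R ^+ 2)^-1).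
  rewrite exchange_big/= !big_nat; apply: eq_bigr => d /andP[d0 _].
  under [RHS]eq_bigr do rewrite -mulrA.
  rewrite -mulr_sumr -mulrA; congr (_ * _); rewrite mulr_sumr.
  rewrite (eq_bigr (fun e => ((d * e)%N%:R ^+ 2)^-1)); last first.
    by move=> e _; rewrite natrM exprMn [RHS]invfM.
  rewrite -(@sum_multiples d D (fun n => (n%:R ^+ 2)^-1))// big_mkcond.
  by apply: eq_bigr => n _; case: ifP; rewrite ?mul1r ?mul0r.
under eq_bigr do rewrite -mulr_suml.
rewrite big_nat (eq_bigr (fun n => (n == 1)%N%:R / n%:R ^+ 2)); last first.
  by move=> n /andP[n0 nD]; rewrite sum_mobius_range.
rewrite -big_nat big_nat_recl// eqxx expr1n divr1 big1_seq ?addr0//.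
move=> n; rewrite mem_index_iota => /andP[_ /andP[n0 _]].
by rewrite eqSS -[n == 0]negbK -lt0n n0 mul0r.
Qed.

Lemma harmonic_sum_le D K : (0 < K)%N ->
  \sum_(1 <= d < D.+1) d%:R^-1 <= D%:R / K%:R + K%:R :> R.
Proof.
move=> K0.
apply: (@le_trans _ _ (\sum_(1 <= d < D.+1) (K%:R^-1 + (d <= K)%N%:R))).
  rewrite !big_nat; apply: ler_sum => d /andP[d0 _]; case: leqP => [_|h].
    by rewrite -[leLHS]add0r lerD ?invr_ge0// invf_le1 ?ltr0n// ler1n.
  by rewrite addr0 lef_pV2 ?posrE ?ltr0n// ler_nat ltnW.
rewrite big_split/= sumr_const_nat subn1 mulr_natl lerD2l -natr_sum ler_nat.
rewrite -[X in (_ <= X)%N](size_iota 1 K) -big_mkcond sum1_count -size_filter.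
apply: uniq_leq_size; first by rewrite filter_uniq// iota_uniq.
by move=> n; rewrite mem_filter mem_iota => /andP[]; rewrite mem_index_iota; lia.
Qed.

(** Replacing each truncated series in [mobius_convolution] by z costs at most
    (2 d / D) / d^2 at d, in total 2/D times a harmonic sum, for which the crude
    bound 2 k^2 is enough when D = k^4. *)
Lemma mobius_sum2_approx (z : R) :
  (forall E, 0 <= z - \sum_(1 <= e < E.+1) (e%:R ^+ 2)^-1 <= 2 / E.+1%:R) ->
  forall k, (0 < k)%N -> `|mobius_sum2 (k ^ 4) * z - 1| <= 4 / k%:R ^+ 2.
Proof.
move=> hz k k0; set D := (k ^ 4)%N.
have kp : 0 < k%:R :> R by rewrite ltr0n.
have D0 : (0 < D)%N by rewrite expn_gt0 k0.
have Dp : 0 < D%:R :> R by rewrite ltr0n.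
rewrite -[X in _ - X](mobius_convolution D0) /mobius_sum2 mulr_suml -sumrB.
apply: (@le_trans _ _ (\sum_(1 <= d < D.+1) (2 / D%:R) * d%:R^-1)).
  apply: le_trans (ler_norm_sum _ _ _) _; rewrite !big_nat.
  apply: ler_sum => d /andP[d0 dD]; rewrite -mulrBr.
  have dp : 0 < d%:R :> R by rewrite ltr0n.
  have /andP[h1 h2] := hz (D %/ d)%N.
  rewrite normrM normrM normfV normrX (ger0_norm (ltW dp)) (ger0_norm h1).
  apply: (@le_trans _ _ (1 * (d%:R ^+ 2)^-1 * (2 * d%:R / D%:R))); last first.
    by rewrite le_eqVlt; apply/orP; left; apply/eqP; field; rewrite !gt_eqF.
  apply: ler_pM; [| exact: h1 | |].
  - by rewrite mulr_ge0 ?normr_ge0 ?invr_ge0 ?exprn_ge0 ?ler0n.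
  - by rewrite ler_wpM2r ?invr_ge0 ?exprn_ge0 ?ler0n ?norm_mobius_le1.
  apply: le_trans h2 _; rewrite -mulrA ler_wpM2l// ler_pdivlMr//.
  rewrite mulrC ler_pdivrMr ?ltr0n// -natrM ler_nat.
  by rewrite mulnC ltnW// ltn_ceil.
rewrite -mulr_sumr.
apply: le_trans (ler_wpM2l _ (harmonic_sum_le D (_ : 0 < k ^ 2)%N)) _.
- by rewrite divr_ge0.
- by rewrite expn_gt0 k0.
rewrite /D !natrX le_eqVlt; apply/orP; left; apply/eqP; field.
by rewrite gt_eqF.
Qed.

End Mobius.

(** * Counting visible points in mean *)

Section Visible.
Variable R : realFieldType.

Lemma coprime_mobius (z : nat * nat) B : (0 < z.1)%N -> (z.1 <= B)%N ->
  (coprime z.1 z.2)%:R = \sum_(1 <= d < B.+1) mobius R d * (divides_pos d z)%:R.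
Proof.
move=> z0 zB; rewrite /coprime -(@sum_mobius_range _ (gcdn z.1 z.2) B).
- by apply: eq_bigr => d _; rewrite /divides_pos dvdn_gcd.
- by rewrite gcdn_gt0 z0.
- by rewrite (leq_trans _ zB)// dvdn_leq// dvdn_gcdl.
Qed.

(** The divisors d <= D each contribute an error O(j^3) with j = D^2, and those
    beyond D contribute O(N / D) in mean: both totals are O(D^7). *)
Lemma visible_count_L1_error a b : (0 < a)%N -> (0 < b)%N -> exists2 C : R, 0 <= C &
  forall D N, (0 < D)%N -> N = (D ^ 8)%N ->
    polyaE N (fun e => `|\sum_(1 <= n < N.+1)
        (coprime (position a b (take n e)).1 (position a b (take n e)).2)%:R
      - N%:R * mobius_sum2 R D|) a b
    <= C * D%:R ^+ 7.
Proof.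
move=> a0 b0; have ab : (0 < a + b)%N by lia.
have [C1 C10 H1] := hits_mean_le R a0 b0.
have [C2 C20 H2] := hits_L1_error R a0 b0.
exists (C1 + C2) => [|D N D0 NE]; first exact: addr_ge0.
have Dp : 0 < D%:R :> R by rewrite ltr0n.
have N0 : (0 < N)%N by rewrite NE expn_gt0 D0.
(* Every common divisor is at most a + N; adding D makes [1, D] a part of the
   range. *)
pose B := (D + (a + N))%N.
pose F e := \sum_(D.+1 <= d < B.+1) hits R d N a b e
  + \sum_(1 <= d < D.+1) `|hits R d N a b e - N%:R / d%:R ^+ 2|.
have hits_ge0 d e : 0 <= hits R d N a b e by apply: sumr_ge0.
apply: (@le_trans _ _ (polyaE N F a b)).
  apply: polyaE_le => e se.
  have -> : \sum_(1 <= n < N.+1)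
        (coprime (position a b (take n e)).1 (position a b (take n e)).2)%:R
      = \sum_(1 <= d < B.+1) mobius R d * hits R d N a b e.
    under [RHS]eq_bigr do rewrite /hits mulr_sumr.
    rewrite [RHS]exchange_big/= !big_nat; apply: eq_bigr => n /andP[_ nN].
    apply: (@coprime_mobius (position a b (take n e))) => /=; first lia.
    have := count_size id (take n e); have := size_take_min n e; lia.
  rewrite (big_cat_nat (n := D.+1))//=; last by rewrite /B; lia.
  rewrite /mobius_sum2 mulr_sumr addrAC -sumrB addrC.
  apply: le_trans (ler_normD _ _) _; apply: lerD.
    apply: le_trans (ler_norm_sum _ _ _) _; apply: ler_sum => d _.
    by rewrite normrM (ger0_norm (hits_ge0 _ _)) ler_piMl// norm_mobius_le1.
  apply: le_trans (ler_norm_sum _ _ _) _; apply: ler_sum => d _.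
  rewrite mulrCA -mulrBr normrM ler_piMl// norm_mobius_le1//.
rewrite polyaED mulrDl; apply: lerD.
  rewrite (polyaE_sum _ _ _ (fun d e => _))//.
  apply: (@le_trans _ _ (C1 * N%:R * \sum_(D.+1 <= d < B.+1) (d%:R ^+ 2)^-1)).
    rewrite mulr_sumr !big_nat; apply: ler_sum => d /andP[d1 _].
    by rewrite -mulrA; apply: H1 => //; lia.
  rewrite -mulrA ler_wpM2l//.
  apply: (@le_trans _ _ (N%:R * D%:R^-1)).
    rewrite ler_wpM2l ?ler0n//; apply: le_trans (sum_inv_sqr_tail R (a + N) D0) _.
    by rewrite lerBlDr lerDl invr_ge0.
  rewrite NE natrX le_eqVlt; apply/orP; left; apply/eqP; field.
  by rewrite gt_eqF.
rewrite (polyaE_sum _ _ _ (fun d e => _))//.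
apply: (@le_trans _ _ (\sum_(1 <= d < D.+1) C2 * (D ^ 2)%N%:R ^+ 3)).
  rewrite !big_nat; apply: ler_sum => d /andP[d1 _].
  by apply: H2; rewrite ?expn_gt0 ?D0// NE -expnM.
rewrite sumr_const_nat subn1 -mulr_natl natrX le_eqVlt; apply/orP; left; apply/eqP.
by ring.
Qed.

End Visible.

(** * The law of the walk *)

Lemma measurable_pair_nat (A : set (nat * nat)) : measurable A.
Proof.
apply: countable_measurable => [[a b]|]; last exact: countableP.
rewrite (_ : [set _] = [set a] `*` [set b]); first exact: measurableX.
by apply/seteqP; split => -[x y]/= => [[-> ->]|[-> ->]].
Qed.

Section Law.
Context (R : realType) (d : measure_display) (T : measurableType d)
  (P : probability T R) (Y : nat -> {RV P >-> (nat * nat)%type}).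

Lemma measurable_position k (A : set (nat * nat)) : measurable [set w | A (Y k w)].
Proof. exact: (measurable_funPTI (Y k) (measurable_pair_nat A)). Qed.

Lemma measurable_path m n (B : pred (seq (nat * nat))) :
  measurable [set w | B [seq Y k w | k <- iota m n]].
Proof.
elim: n m B => [|n IH] m B /=.
  have [b|b] := boolP (B [::]).
    by rewrite (_ : [set _ | _] = setT)//; apply/seteqP; split.
  by rewrite (_ : [set _ | _] = set0)//; apply/seteqP; split.
rewrite (_ : [set _ | _] = \bigcup_(x : nat * nat)
   ([set w | Y m w = x] `&` [set w | B (x :: [seq Y k w | k <- iota m.+1 n])])).
  apply: countable_bigcupT_measurable => [|x]; first exact: countableP.
  apply: measurableI; first exact: (measurable_position m [set x]).
  exact: (IH m.+1 (fun s => B (x :: s))).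
apply/seteqP; split => w /= => [Bw|[x _ [<-]]//].
by exists (Y m w).
Qed.

Lemma measurable_history n h : measurable (history Y n h).
Proof.
rewrite (_ : history _ _ _ = \bigcap_(k in [set k | (k <= n)%N]) [set w | Y k w = h k]).
  by apply: bigcap_measurableType => k _; exact: (measurable_position k [set h k]).
by apply/seteqP; split => w /= H k; apply: H.
Qed.

Variables (a0 b0 : nat).
Hypothesis (ha0 : (0 < a0)%N).
Hypothesis hY : polya_walk Y a0 b0.

(** Indexing histories by steps rather than by positions leaves out the paths
    with an impossible move. *)
Definition cylinder (e : seq bool) : set T :=
  history Y (size e) (fun k => position a0 b0 (take k e)).

Lemma measurable_cylinder e : measurable (cylinder e).
Proof. exact: measurable_history. Qed.

Lemma cylinder_nil : cylinder [::] = setT.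
Proof.
apply/seteqP; split => w //= _ k; rewrite leqn0 => /eqP ->.
by rewrite (polya_start hY) /position/= !addn0.
Qed.

Lemma cylinder_last e w : cylinder e w -> Y (size e) w = position a0 b0 e.
Proof. by move=> /(_ _ (leqnn _)); rewrite take_size. Qed.

Lemma cylinder_rcons e s : cylinder (rcons e s)
  = cylinder e `&` [set w | Y (size e).+1 w = position a0 b0 (rcons e s)].
Proof.
rewrite /cylinder /history size_rcons; apply/seteqP; split => w /=.
  move=> H; split => [k ke|]; last by rewrite H// -(size_rcons e s) take_size.
  by rewrite H ?leqW// -cats1 takel_cat.
move=> [H1 H2] k; rewrite leq_eqVlt => /predU1P[->|]; last first.
  by rewrite ltnS => ke; rewrite -cats1 takel_cat// H1.
by rewrite -(size_rcons e s) take_size size_rcons.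
Qed.

Let pr (A : set T) : R := fine (P A).

Let prE A : measurable A -> P A = (pr A)%:E.
Proof. by move=> mA; rewrite fineK// fin_num_measure. Qed.

Let pr_ge0 A : 0 <= pr A. Proof. exact: fine_ge0. Qed.

Let pr_le A B : measurable A -> measurable B -> A `<=` B -> pr A <= pr B.
Proof.
by move=> mA mB AB; rewrite -lee_fin -!prE// le_measure ?inE.
Qed.

Let pr_cut A B : measurable A -> measurable B ->
  pr A = pr (A `&` B) + pr (A `\` B).
Proof.
move=> mA mB; have mI := measurableI _ _ mA mB; have mD := measurableD mA mB.
apply: EFin_inj; rewrite EFinD -!prE// -measureU//.
  by rewrite setUIDK.
by apply/seteqP; split => // w [[_ ?] [_ ?]].
Qed.

(** Multiplying out the denominator lets the statement cover the histories of
    probability zero, on which the conditional probabilities say nothing. *)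
Lemma pr_cylinder_rcons e (s : bool) :
  pr (cylinder (rcons e s)) * ((position a0 b0 e).1 + (position a0 b0 e).2)%:R
  = pr (cylinder e) * (if s then (position a0 b0 e).1 else (position a0 b0 e).2)%:R.
Proof.
have [P0|P0] := eqVneq (P (cylinder e)) 0%E.
  have e0 : pr (cylinder e) = 0 by rewrite /pr P0.
  have : pr (cylinder (rcons e s)) <= 0.
    rewrite -e0; apply: pr_le; try exact: measurable_cylinder.
    by rewrite cylinder_rcons => w [].
  have := pr_ge0 (cylinder (rcons e s)).
  rewrite e0 mul0r => p1 p2; rewrite (_ : pr _ = 0) ?mul0r//.
  by apply/eqP; rewrite eq_le p2.
have pe0 : pr (cylinder e) != 0 by rewrite -eqe -prE//; exact: measurable_cylinder.
have pos : ((position a0 b0 e).1 + (position a0 b0 e).2)%:R != 0 :> R.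
  by rewrite pnatr_eq0 /= -lt0n !addn_gt0 ha0.
have cyl (F : nat * nat -> nat * nat) :
    F (position a0 b0 e) = position a0 b0 (rcons e s) ->
    cond_prob P [set w | Y (size e).+1 w = F (Y (size e) w)] (cylinder e)
    = pr (cylinder (rcons e s)) / pr (cylinder e).
  move=> FE; rewrite /cond_prob cylinder_rcons -FE; congr (fine (P _) / _).
  by apply/seteqP; split => w [A B]; split => //=; [move: A|];
    rewrite /= cylinder_last.
have count_rcons q : count q (rcons e s) = (count q e + q s)%N.
  by rewrite -cats1 count_cat/= addn0.
case: s cyl count_rcons => cyl count_rcons.
  have := polya_right hY P0; rewrite take_size.
  rewrite (cyl (fun z => ((z.1 + 1)%N, z.2))); last first.
    by rewrite /position !count_rcons/= addn0 addnA.
  by move=> /eqP; rewrite eqr_div// => /eqP ->; rewrite mulrC.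
have := polya_up hY P0; rewrite take_size.
rewrite (cyl (fun z => (z.1, (z.2 + 1)%N))); last first.
  by rewrite /position !count_rcons/= addn0 addnA.
by move=> /eqP; rewrite eqr_div// => /eqP ->; rewrite mulrC.
Qed.

Lemma position_rcons e s : position a0 b0 (rcons e s)
  = (if s then ((position a0 b0 e).1.+1, (position a0 b0 e).2)
     else ((position a0 b0 e).1, (position a0 b0 e).2.+1)).
Proof.
by rewrite /position -!cats1 !count_cat/=; case: s; rewrite /= ?addn0 ?addn1 ?addnS.
Qed.

Lemma positions_cons a b (s : bool) e n :
  [seq position a b (take k (s :: e)) | k <- iota 1 n.+1]
  = (if s then (a.+1, b) else (a, b.+1))
    :: [seq (if s then position a.+1 b (take k e) else position a b.+1 (take k e))
       | k <- iota 1 n].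
Proof.
rewrite /= take0 -[X in iota X n]add1n iotaDl -map_comp; congr (_ :: _).
  by case: s; rewrite /position /= ?addn0 ?addn1.
apply: eq_map => k /=.
by case: s; rewrite /position/= ?add0n ?add1n ?addnS ?addSn.
Qed.

(** Induction on the number of remaining steps, splitting on the next one.  An
    inequality is enough for the estimates, and it lets the null event of a
    forbidden jump be discarded. *)
Lemma polya_law_from e n (B : pred (seq (nat * nat))) :
  pr (cylinder e `&` [set w | B [seq Y k w | k <- iota (size e).+1 n]])
  <= pr (cylinder e) * polyaE n (fun e' => (B [seq
        position (position a0 b0 e).1 (position a0 b0 e).2 (take k e')
        | k <- iota 1 n])%:R)
       (position a0 b0 e).1 (position a0 b0 e).2.
Proof.
have mB m n' B' := measurable_path m n' B'.
have mC := measurable_cylinder.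
elim: n e B => [|n IH] e B.
  rewrite /=; case: (B [::]) => /=.
    rewrite mulr1 (_ : cylinder e `&` _ = cylinder e)//.
    by apply/seteqP; split => w // [].
  rewrite mulr0 (_ : cylinder e `&` _ = set0) ?/pr ?measure0//.
  by apply/seteqP; split => w // [].
set S := _ `&` _.
have mS : measurable S by apply: measurableI.
pose J s := [set w | Y (size e).+1 w = position a0 b0 (rcons e s)].
have mJ s : measurable (J s).
  exact: (measurable_position _ [set position a0 b0 (rcons e s)]).
have CJ s : cylinder e `&` J s = cylinder (rcons e s) by rewrite cylinder_rcons.
set p := position a0 b0 e.
have pos : 0 < (p.1 + p.2)%:R :> R by rewrite ltr0n /= !addn_gt0 ha0.
have prC s : pr (cylinder (rcons e s))
    = pr (cylinder e) * (if s then p.1 else p.2)%:R / (p.1 + p.2)%:R.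
  by rewrite /p -pr_cylinder_rcons mulfK ?gt_eqF.
have dJ : (cylinder e `\` J true) `&` J false = cylinder e `&` J false.
  apply/seteqP; split => w [].
    by move=> [Cw _] Jw.
  move=> Cw Jw; split => //; split => //; rewrite /J/= Jw !position_rcons => -[].
  lia.
(* The conditional probabilities of the two moves add up to 1. *)
have null : pr (cylinder e `\` J true `\` J false) = 0.
  have := pr_cut (mC e) (mJ true).
  rewrite (pr_cut (measurableD (mC e) (mJ true)) (mJ false)) dJ !CJ !prC.
  have -> : pr (cylinder e) * p.1%:R / (p.1 + p.2)%:R
    = pr (cylinder e) - pr (cylinder e) * p.2%:R / (p.1 + p.2)%:R.
    by rewrite natrD in pos *; field; rewrite gt_eqF.
  lra.
have step s : pr (S `&` J s) <= pr (cylinder (rcons e s)) *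
    (if s then
       polyaE n (fun e' => (B [seq position p.1 p.2 (take k (true :: e'))
          | k <- iota 1 n.+1])%:R) p.1.+1 p.2
     else
       polyaE n (fun e' => (B [seq position p.1 p.2 (take k (false :: e'))
          | k <- iota 1 n.+1])%:R) p.1 p.2.+1).
  have := IH (rcons e s) (fun t => B (position a0 b0 (rcons e s) :: t)).
  move=> {}IH; apply: le_trans (le_trans IH _).
    apply: pr_le; [exact: measurableI|apply: measurableI => //|].
      exact: (mB _ _ (fun t => B (position a0 b0 (rcons e s) :: t))).
    move=> w [[Cw /= Bw] Jw]; rewrite -CJ size_rcons; split => //=.
    by rewrite -Jw.
  rewrite ler_wpM2l// position_rcons -/p; case: (s); apply: polyaE_le => e' _.
    by rewrite (@positions_cons _ _ true).
  by rewrite (@positions_cons _ _ false).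
rewrite (pr_cut mS (mJ true)) (pr_cut (measurableD mS (mJ true)) (mJ false)).
have mSt := measurableD mS (mJ true).
have h3 : pr (S `\` J true `\` J false) <= 0.
  rewrite -null; apply: pr_le; [exact: measurableD| |].
    by apply: measurableD => //; exact: measurableD.
  by move=> w [[[Cw _] J1] J2].
have h2 : pr ((S `\` J true) `&` J false) <= pr (S `&` J false).
  apply: pr_le; [exact: measurableI|exact: measurableI|].
  by move=> w [[Sw _] J1].
have := step true; have := step false; rewrite !prC.
rewrite [polyaE n.+1 _ _ _](_ : _ = (p.1%:R *
   polyaE n (fun e' => (B [seq position p.1 p.2 (take k (true :: e'))
          | k <- iota 1 n.+1])%:R) p.1.+1 p.2
   + p.2%:R * polyaE n (fun e' => (B [seq position p.1 p.2 (take k (false :: e'))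
          | k <- iota 1 n.+1])%:R) p.1 p.2.+1) / (p.1 + p.2)%:R)//.
set Et := polyaE n _ p.1.+1 p.2; set Ef := polyaE n _ p.1 p.2.+1 => s2 s1.
rewrite [leRHS](_ : _ = pr (cylinder e) * p.1%:R / (p.1 + p.2)%:R * Et
  + pr (cylinder e) * p.2%:R / (p.1 + p.2)%:R * Ef); last by ring.
lra.
Qed.

Lemma polya_law n (B : pred (seq (nat * nat))) :
  (P [set w | B [seq Y k w | k <- iota 1 n]]
  <= (polyaE n (fun e => (B [seq position a0 b0 (take k e) | k <- iota 1 n])%:R)
       a0 b0)%:E)%E.
Proof.
rewrite prE ?lee_fin; last exact: measurable_path.
have := polya_law_from [::] n B.
by rewrite cylinder_nil setTI {2}/pr probability_setT/= mul1r !addn0.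
Qed.

End Law.

(** * The value of the constant *)

Section Zeta.
Variable R : realType.

Lemma series_riemannR2 n :
  series (riemannR (2 : R)) n = \sum_(1 <= e < n.+1) (e%:R ^+ 2)^-1.
Proof.
rewrite /series/= big_add1/=; apply: eq_bigr => k _.
by rewrite -powR_mulrn.
Qed.

Lemma zeta2_tail E :
  0 <= zeta (2 : R) - \sum_(1 <= e < E.+1) (e%:R ^+ 2)^-1 <= 2 / E.+1%:R.
Proof.
have nd : nondecreasing_seq (series (riemannR (2 : R))).
  apply/nondecreasing_seqP => n; rewrite /series/= big_nat_recr//= lerDl.
  by rewrite invr_ge0 powR_ge0.
have tail D n : (0 < D)%N ->
    series (riemannR (2 : R)) n <= \sum_(1 <= e < D.+1) (e%:R ^+ 2)^-1 + D%:R^-1.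
  move=> D0; apply: le_trans (_ : series (riemannR (2 : R)) (D + n) <= _).
    by apply: nd; exact: leq_addl.
  rewrite series_riemannR2 (big_cat_nat (n := D.+1))//=; last by rewrite ltnS leq_addr.
  rewrite lerD2l -addSn; apply: le_trans (sum_inv_sqr_tail R n D0) _.
  by rewrite lerBlDr lerDl invr_ge0.
have cv : cvgn (series (riemannR (2 : R))).
  apply: nondecreasing_is_cvgn => //.
  by exists (\sum_(1 <= e < 2) (e%:R ^+ 2)^-1 + 1%:R^-1) => _ [n _ <-]; exact: tail.
have le_tail D : (0 < D)%N ->
    zeta (2 : R) <= \sum_(1 <= e < D.+1) (e%:R ^+ 2)^-1 + D%:R^-1.
  by move=> D0; apply: limr_le => //; apply: nearW => n; exact: tail.
apply/andP; split.
  by rewrite subr_ge0 -series_riemannR2; exact: nondecreasing_cvgn_le.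
rewrite lerBlDr addrC; case: E => [|E].
  rewrite big_geq// add0r divr1; apply: le_trans (le_tail 1%N isT) _.
  by rewrite big_nat1 expr1n invr1.
apply: le_trans (le_tail E.+1 isT) _; rewrite lerD2l.
by rewrite ler_pdivlMr ?ltr0n// mulrC ler_pdivrMr ?ltr0n// -natrM ler_nat; lia.
Qed.

Lemma mobius_sum2_limit k : (0 < k)%N ->
  `|mobius_sum2 R (k ^ 4) - (zeta (2 : R))^-1| <= 4 / k%:R ^+ 2.
Proof.
move=> k0; have := mobius_sum2_approx (@zeta2_tail) k0.
have z1 : 1 <= zeta (2 : R).
  have := zeta2_tail 1; rewrite big_nat1 expr1n invr1 => /andP[+ _].
  by rewrite subr_ge0.
have zp : 0 < zeta (2 : R) by rewrite (lt_le_trans _ z1).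
move=> H; apply: le_trans _ H.
set z := zeta _ in z1 zp *; set c := mobius_sum2 _ _.
rewrite [X in _ <= `|X|](_ : _ = (c - z^-1) * z); last by field; rewrite gt_eqF.
by rewrite normrM ler_peMr// ger0_norm// ltW.
Qed.

End Zeta.

(** * From a sparse subsequence to the whole sequence *)

Section Interpolation.
Variable R : realType.

Lemma bernoulli_inequality (x : R) n : 0 <= x <= 1 -> 1 - n%:R * x <= (1 - x) ^+ n.
Proof.
move=> x01; elim: n => [|n IH]; first by rewrite mul0r subr0 expr0.
rewrite exprS -natr1; have := ler0n R n; nra.
Qed.

Variable X : nat -> R.
Hypothesis X01 : forall n, 0 <= X n <= 1.

Let S N := \sum_(1 <= n < N.+1) X n.

(** Passing from K to N terms adds at most N - K to the sum and changes the
    normalisation by the factor K/N. *)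
Lemma mean_interpolation K N : (0 < K <= N)%N ->
  `|N%:R^-1 * S N - K%:R^-1 * S K| <= 2 * (1 - K%:R / N%:R).
Proof.
move=> /andP[K0 KN]; have Kp : 0 < K%:R :> R by rewrite ltr0n.
have N0 : (0 < N)%N by lia.
have Np : 0 < N%:R :> R by rewrite ltr0n.
have S0 M : 0 <= S M by apply: sumr_ge0 => n _; have /andP[] := X01 n.
have SK : S K <= K%:R.
  rewrite [leRHS](_ : _ = \sum_(1 <= n < K.+1) 1); last by rewrite sumr_const_nat subn1.
  by apply: ler_sum => n _; have /andP[] := X01 n.
have SN : S K <= S N <= S K + (N%:R - K%:R).
  have -> : S N = S K + \sum_(K.+1 <= n < N.+1) X n.
    by rewrite /S [LHS](big_cat_nat (n := K.+1)).
  rewrite lerDl lerD2l; apply/andP; split.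
    by apply: sumr_ge0 => n _; have /andP[] := X01 n.
  rewrite [leRHS](_ : _ = \sum_(K.+1 <= n < N.+1) 1); last first.
    by rewrite sumr_const_nat subSS natrB.
  by apply: ler_sum => n _; have /andP[] := X01 n.
have KNr : K%:R <= N%:R :> R by rewrite ler_nat.
set x : R := K%:R in Kp SK SN KNr *; set y : R := N%:R in Np SN KNr *.
have -> : y^-1 * S N - x^-1 * S K = (S N - S K) / y - (S K / x) * ((y - x) / y).
  by field; rewrite !gt_eqF.
have -> : 2 * (1 - x / y) = (y - x) / y + 1 * ((y - x) / y).
  by field; rewrite gt_eqF.
apply: le_trans (ler_normB _ _) _; have yx : 0 <= (y - x) / y.
  by rewrite divr_ge0// ?subr_ge0// ltW.
have /andP[SN1 SN2] := SN.
apply: lerD.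
  rewrite ger0_norm ?divr_ge0 ?subr_ge0// ?(ltW Np)//.
  by rewrite ler_wpM2r ?invr_ge0 ?(ltW Np)// lerBlDr addrC.
rewrite ger0_norm; last by rewrite !mulr_ge0 ?invr_ge0 ?subr_ge0 ?(ltW Kp) ?(ltW Np).
by rewrite ler_wpM2r// ler_pdivrMr// mul1r.
Qed.

(** Consecutive powers k^m and (k + 1)^m have a ratio 1 - O(1/k), so the mean
    moves by O(1/k) between them. *)
Lemma cvg_mean_along_powers m (l C : R) K0 : (0 < m)%N -> 0 <= C ->
  (forall k, (K0 <= k)%N ->
    `|(k.+1 ^ m)%:R^-1 * S (k.+1 ^ m) - l| <= C / k.+1%:R) ->
  N%:R^-1 * S N @[N --> \oo] --> l.
Proof.
move=> m0 C0 H; apply/cvgrPdist_le => e e0.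
have C'0 : 0 <= C + 2 * m%:R by rewrite addr_ge0// mulr_ge0.
have [k1 hk1] : exists k1, (C + 2 * m%:R) / e < k1%:R.
  by exists (Num.bound ((C + 2 * m%:R) / e)); rewrite archi_boundP// divr_ge0// ltW.
near=> N.
pose q k := (k.+1 ^ m <= N)%N.
have exq : exists k, q k.
  by exists (maxn K0 k1); rewrite /q; near: N; exact: nbhs_infty_ge.
have ubq k : q k -> (k <= N)%N.
  move=> qk; apply: leq_trans qk; apply: leq_trans (leqnSn k) _.
  by rewrite -{1}(expn1 k.+1) leq_pexp2l.
case: (ex_maxnP exq ubq) => k qk kmax.
have kK : (maxn K0 k1 <= k)%N.
  by apply: kmax; rewrite /q; near: N; exact: nbhs_infty_ge.
have {kmax} Nk : (N < k.+2 ^ m)%N.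
  by rewrite ltnNge; apply/negP => h; have := kmax _ h; rewrite ltnn.
rewrite distrC.
have -> : N%:R^-1 * S N - l = (N%:R^-1 * S N - (k.+1 ^ m)%:R^-1 * S (k.+1 ^ m))
   + ((k.+1 ^ m)%:R^-1 * S (k.+1 ^ m) - l) by rewrite addrA subrK.
apply: le_trans (ler_normD _ _) _.
have k1p : 0 < k.+1%:R :> R by rewrite ltr0n.
have N0 : (0 < N)%N by apply: leq_trans qk; rewrite expn_gt0.
have h1 : `|N%:R^-1 * S N - (k.+1 ^ m)%:R^-1 * S (k.+1 ^ m)| <= 2 * m%:R / k.+1%:R.
  apply: le_trans (mean_interpolation _) _; first by rewrite expn_gt0 /=; exact: qk.
  rewrite -mulrA ler_wpM2l// lerBlDr -lerBlDl.
  apply: (@le_trans _ _ ((1 - k.+2%:R^-1) ^+ m)).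
    apply: le_trans _ (bernoulli_inequality m _); last first.
      by rewrite invr_ge0 ler0n/= invf_le1 ?ltr0n// ler1n.
    by rewrite lerD2l lerN2 ler_wpM2l// lef_pV2 ?posrE ?ltr0n// ler_nat.
  have -> : 1 - k.+2%:R^-1 = k.+1%:R / k.+2%:R :> R.
    rewrite -(natr1 k.+1); set x : R := k.+1%:R in k1p *.
    by field; rewrite gt_eqF// addr_gt0.
  rewrite expr_div_n -!natrX ler_wpM2l// lef_pV2 ?posrE ?ltr0n ?expn_gt0//.
  by rewrite ler_nat ltnW.
have h2 := H k (leq_trans (leq_maxl _ _) kK).
apply: le_trans (lerD h1 h2) _; rewrite -mulrDl addrC ler_pdivrMr//.
rewrite [leRHS]mulrC -ler_pdivrMr// (le_trans (ltW hk1))// ler_nat.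
by apply: leqW; exact: leq_trans (leq_maxr _ _) kK.
Unshelve. all: by end_near. Qed.

End Interpolation.

(** * Almost sure convergence *)

Section AlmostSure.
Context (R : realType) (d : measure_display) (T : measurableType d)
  (P : probability T R) (Y : nat -> {RV P >-> (nat * nat)%type}) (a0 b0 : nat).
Hypotheses (ha0 : (0 < a0)%N) (hb0 : (0 < b0)%N) (hY : polya_walk Y a0 b0).

Lemma visible_mean_path N w :
  visible_mean R Y N w
  = N%:R^-1 * \sum_(z <- [seq Y k w | k <- iota 1 N]) (coprime z.1 z.2)%:R.
Proof. by rewrite /visible_mean big_map /index_iota subn1. Qed.

Lemma measurable_deviation N (c eps : R) :
  measurable [set w | (eps <= `|visible_mean R Y N w - c|)%R].
Proof.
pose B (s : seq (nat * nat)) :=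
  eps <= `|N%:R^-1 * \sum_(z <- s) (coprime z.1 z.2)%:R - c|.
rewrite (_ : [set w | _] = [set w | B [seq Y j w | j <- iota 1 N]]).
  exact: measurable_path.
by apply/seteqP; split => w; rewrite /mkset /B visible_mean_path.
Qed.

(** The Markov inequality for the bound of [visible_count_L1_error], transported
    to the walk by [polya_law]. *)
Lemma deviation_probability : exists2 C : R, 0 <= C &
  forall D N (eps : R), (0 < D)%N -> N = (D ^ 8)%N -> 0 < eps ->
  (P [set w | (eps <= `|visible_mean R Y N w - mobius_sum2 R D|)%R]
   <= (C / (eps * D%:R))%:E)%E.
Proof.
have [C C0 HC] := visible_count_L1_error R ha0 hb0; exists C => // D N eps D0 NE eps0.
have Dp : 0 < D%:R :> R by rewrite ltr0n.
have Np : 0 < N%:R :> R by rewrite ltr0n NE expn_gt0 D0.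
pose c := mobius_sum2 R D.
pose B (s : seq (nat * nat)) :=
  eps <= `|N%:R^-1 * \sum_(z <- s) (coprime z.1 z.2)%:R - c|.
rewrite [X in P X](_ : _ = [set w | B [seq Y j w | j <- iota 1 N]]); last first.
  by apply/seteqP; split => w; rewrite /mkset /B visible_mean_path.
apply: le_trans (polya_law ha0 hY N B) _; rewrite lee_fin.
pose F e : R := `|\sum_(1 <= n < N.+1)
        (coprime (position a0 b0 (take n e)).1 (position a0 b0 (take n e)).2)%:R
      - N%:R * c|.
apply: (@le_trans _ _ (polyaE N (fun e => (eps^-1 / N%:R) * F e) a0 b0)).
  apply: polyaE_le => e _; case: (boolP (B _)) => [h|_]; last first.
    by rewrite !mulr_ge0 ?normr_ge0 ?invr_ge0 ?(ltW eps0) ?(ltW Np).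
  rewrite -mulrA ler_pdivlMl// mulr1; apply: le_trans h _.
  rewrite big_map (_ : iota 1 N = index_iota 1 N.+1); last by rewrite /index_iota subn1.
  rewrite /F -[N%:R^-1 in leRHS]ger0_norm ?invr_ge0 ?(ltW Np)// -normrM.
  by rewrite mulrBr mulrA mulVf ?gt_eqF// mul1r.
rewrite polyaEZ; apply: le_trans (ler_wpM2l _ (HC D N D0 NE)) _.
  by rewrite mulr_ge0 ?invr_ge0 ?(ltW eps0) ?(ltW Np).
rewrite NE natrX le_eqVlt; apply/orP; left; apply/eqP; field.
by rewrite !gt_eqF.
Qed.

(** With D = (k + 1)^4 and a deviation of 1/(k + 1), the probabilities are at most
    C / (k + 1)^3, hence summable; the Borel-Cantelli lemma applies. *)
Lemma ae_visible_mean_powers : {ae P, forall w, exists K0, forall k, (K0 <= k)%N ->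
  `|visible_mean R Y (k.+1 ^ 32) w - mobius_sum2 R (k.+1 ^ 4)| <= k.+1%:R^-1}.
Proof.
have [C C0 HC] := deviation_probability.
pose F k := [set w | ((k.+1)%:R^-1 <=
     `|visible_mean R Y (k.+1 ^ 32) w - mobius_sum2 R (k.+1 ^ 4)|)%R].
have mF k : measurable (F k) by exact: measurable_deviation.
exists (lim_sup_set F); split.
- by apply: bigcap_measurableType => n _; exact: bigcup_measurable.
- apply: lim_sup_set_cvg0 => //.
  apply: (@le_lt_trans _ _ (C * 2)%:E); last exact: ltry.
  apply: lime_le; first exact: is_cvg_nneseries.
  apply: nearW => n.
  apply: (@le_trans _ _ (\sum_(0 <= k < n) (C / k.+1%:R ^+ 2)%:E)%E).
    apply: lee_sum => k _; have kp : 0 < k.+1%:R :> R by rewrite ltr0n.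
    apply: le_trans (HC (k.+1 ^ 4)%N _ _ _ _ _) _; rewrite ?expn_gt0 ?invr_gt0//.
      by rewrite -expnM.
    rewrite lee_fin natrX [X in C / X](_ : _ = k.+1%:R ^+ 3); last first.
      by rewrite exprS mulKf ?gt_eqF.
    by rewrite ler_wpM2l// lef_pV2 ?posrE ?exprn_gt0// ler_weXn2l ?ler1n.
  rewrite sumEFin lee_fin -mulr_sumr ler_wpM2l//.
  have /andP[h1 _] := zeta2_tail R n; have /andP[_ h2] := zeta2_tail R 0.
  move: h1 h2; rewrite big_add1/= [X in _ - X <= _]big_geq//; lra.
- move=> w /= nw n _; apply: contrapT => nFn; apply: nw; exists n => k nk.
  rewrite leNgt; apply/negP => /ltW h; apply: nFn.
  by exists k.
Qed.

End AlmostSure.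

Theorem theorem1 (R : realType) (d : measure_display) (T : measurableType d)
    (P : probability T R) (a0 b0 : nat) (ha0 : (0 < a0)%N) (hb0 : (0 < b0)%N)
    (Y : nat -> {RV P >-> (nat * nat)%type}) (hY : polya_walk Y a0 b0) :
  {ae P, forall w, visible_mean R Y N w @[N --> \oo] --> (zeta (2 : R))^-1}.
Proof.
move: (ae_visible_mean_powers ha0 hb0 hY); apply: filterS => w [K0 HK].
apply: (@cvg_mean_along_powers R (fun n => visible R (Y n w)) _ 32 _ 5 K0) => //.
  by move=> n; rewrite /visible; case: coprime; rewrite ?ler01 ?lexx.
move=> k Kk; have := HK k Kk; have := mobius_sum2_limit R (ltn0Sn k).
rewrite /visible_mean; move: (k.+1 ^ 32)%N => N h1 h2.
apply: le_trans (ler_distD (mobius_sum2 R (k.+1 ^ 4)) _ _) _.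
apply: le_trans (lerD h2 h1) _.
have kp : 1 <= k.+1%:R :> R by rewrite ler1n.
rewrite [leRHS](_ : _ = k.+1%:R^-1 + 4 / k.+1%:R); last by ring.
rewrite lerD2l ler_wpM2l// lef_pV2 ?posrE ?exprn_gt0 ?(lt_le_trans _ kp)//.
by rewrite expr2 ler_peMr ?(le_trans _ kp).
Qed.
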